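(* Fix a dimension $D\geqslant 2$. For every integer $n$ and every integer $k$ with $0<k<n$, $$\delta(n,k) \geqslant \frac{2}{\pi}\Big\lfloor \frac{n}{k+1}\Big\rfloor - 1.$$
   Context: For a graph $G$ whose vertices are points in $\mathbb{R}^D$, each edge $(u,v)$ has weight equal to the Euclidean distance $d(u,v)$ (edges may cross or overlap), and $d_G(u,v)$ is the length of a shortest path in $G$ between $u$ and $v$. The dilation of $G$ is $\Delta(G)=\max_{u\neq v\in V(G)} d_G(u,v)/d(u,v)$ (infinite if $G$ is disconnected). For a finite set $S$ of $n$ points and an integer $k\ge0$, $\Delta(S,k)$ is the minimum of $\Delta(G)$ over all graphs $G$ with vertex set exactly $S$ and exactly $n-1+k$ edges. $\delta(n,k)=\sup\{\Delta(S,k): S\subset\mathbb{R}^D,\ |S|=n\}$. *)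

(* Defs.v *)
From HB Require Import structures.
From mathcomp Require Import all_boot all_order all_algebra.
From mathcomp Require Import all_classical all_reals all_analysis.
Set Implicit Arguments. Unset Strict Implicit. Unset Printing Implicit Defensive.
Import Order.TTheory GRing.Theory Num.Theory.
Local Open Scope ring_scope.
Local Open Scope classical_set_scope.

Section Dilation.
Variables (R : realType) (D n : nat).

Definition edist (x y : 'rV[R]_D) : R :=
  Num.sqrt (\sum_(i < D) (x ord0 i - y ord0 i) ^+ 2).

(* A point set S of n points is given by an injective map p : 'I_n -> R^D.
   A (simple, undirected) graph on S is a set of edges E, each edge (i,j)
   stored once with i < j. *)
Definition is_edge_set (E : {set 'I_n * 'I_n}) : Prop :=
  forall e, e \in E -> (e.1 < e.2)%N.

Definition adj (E : {set 'I_n * 'I_n}) (a b : 'I_n) : bool :=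
  ((a, b) \in E) || ((b, a) \in E).

Definition walk (E : {set 'I_n * 'I_n}) (u v : 'I_n) (s : seq 'I_n) : bool :=
  path (adj E) u s && (last u s == v).

Fixpoint walk_len (p : 'I_n -> 'rV[R]_D) (x : 'I_n) (s : seq 'I_n) : R :=
  match s with
  | [::] => 0
  | y :: s' => edist (p x) (p y) + walk_len p y s'
  end.

(* Shortest-path distance d_G(u,v) (+oo if no path). *)
Definition graph_dist (p : 'I_n -> 'rV[R]_D) (E : {set 'I_n * 'I_n})
    (u v : 'I_n) : \bar R :=
  ereal_inf [set (walk_len p u s)%:E | s in [set s | walk E u v s]].

(* Dilation Delta(G) = max_{u <> v} d_G(u,v) / d(u,v) (+oo if disconnected). *)
Definition dilation (p : 'I_n -> 'rV[R]_D) (E : {set 'I_n * 'I_n}) : \bar R :=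
  ereal_sup [set (graph_dist p E uv.1 uv.2 * ((edist (p uv.1) (p uv.2))^-1)%:E)%E
            | uv in [set uv : 'I_n * 'I_n | uv.1 != uv.2]].

(* Delta(S,k): minimum dilation over graphs on S with exactly n-1+k edges
   (ereal_inf of the empty family is +oo). *)
Definition Delta_S (p : 'I_n -> 'rV[R]_D) (k : nat) : \bar R :=
  ereal_inf [set dilation p E | E in
     [set E : {set 'I_n * 'I_n} | is_edge_set E /\ #|E| = (n.-1 + k)%N]].

Definition delta (k : nat) : \bar R :=
  ereal_sup [set Delta_S p k | p in [set p : 'I_n -> 'rV[R]_D | injective p]].

End Dilation.

(* Main.v *)
(* Take at least [k + 1] far-apart clusters, each (but possibly the last) a
   regular [m]-gon, with [m = n %/ k.+1].  A connected graph with [n - 1 + k]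
   edges has a cycle space of dimension [k].  On each of [k + 1] clusters
   consider the 1-cochain sending an edge to the signed number of polygon steps
   of the shorter way round; these [k + 1] cochains are dependent modulo
   coboundaries, so on some cluster the signed step count has a potential [g].
   Around the polygon the increments of [g] between consecutive corners sum to
   0 instead of [m], so some increment differs from 1; being congruent to 1
   modulo [m], it is at least [m - 1] in absolute value as soon as the two
   corners are joined inside the cluster.  By Jordan's inequality [t] steps cost
   length at least [4 t / m], so the detour has length at least [4 - 4 / m],
   while a side [d] of the polygon satisfies [4 / m <= d <= 2 pi / m]. *)
Require Import Defs.
From HB Require Import structures.
From mathcomp Require Import all_boot all_order all_algebra.
From mathcomp Require Import all_classical all_reals all_analysis.
From mathcomp Require Import zify ring lra.
Import Order.TTheory GRing.Theory Num.Theory.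
Import numFieldNormedType.Exports.
Local Open Scope ring_scope.

(** * Sine estimates and signed arcs *)

Lemma sin_MVT {R : realType} (a b : R) : a <= b ->
  exists2 c, a <= c <= b & sin b - sin a = cos c * (b - a).
Proof.
move=> ab; have [|c cab ->] := @MVT_segment R sin cos a b ab (fun y _ => is_derive_sin y).
  by apply: continuous_subspaceT; exact: continuous_sin.
by exists c => //; rewrite in_itv in cab.
Qed.

Lemma sin_le_id {R : realType} (x : R) : 0 <= x -> sin x <= x.
Proof.
move=> x0; have [c _] := sin_MVT 0 x x0; rewrite sin0 !subr0 => ->.
by rewrite ler_piMl // cos_le1.
Qed.

(** Concavity via mean slopes: [cos c1] is the slope of the sine over [0, x] and [cos c2] that over
    [x, pi/2]. As [c1 <= c2] and the cosine decreases on [0, pi], the graph stays on or above the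
    chord from 0 to pi/2. *)
Lemma jordan_sin {R : realType} (x : R) :
  0 <= x <= pi / 2 -> 2 / pi * x <= sin x.
Proof.
have pi0 := pi_gt0 R; move=> /andP[x0 x1].
have [c1 /andP[c10 c1x]] := sin_MVT 0 x x0.
have [c2 /andP[xc2 c2p]] := sin_MVT x (pi / 2) x1.
rewrite sin_pihalf sin0 !subr0 => e2 e1.
have cc : cos c2 <= cos c1.
  have c1I : c1 \in `[0, pi] by rewrite in_itv /=; apply/andP; split; lra.
  have c2I : c2 \in `[0, pi] by rewrite in_itv /=; apply/andP; split; lra.
  by rewrite leNgt ltr_cos // -leNgt (le_trans c1x).
have H : (pi / 2 - x) * x * cos c2 <= (pi / 2 - x) * x * cos c1.
  by apply: ler_wpM2l => //; rewrite mulr_ge0 // subr_ge0.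
rewrite mulrAC ler_pdivrMr //.
nra.
Qed.

(* The representative of [d] modulo [m] of least absolute value, made odd in
   [d]: the signed number of steps of the short way round an [m]-gon between
   two corners whose labels differ by [d]. *)
Definition short_arc (m : nat) (d : int) : int :=
  if m%:Z < d + d then d - m%:Z else if d + d < - m%:Z then d + m%:Z else d.

Lemma short_arcN (m : nat) (d : int) : short_arc m (- d) = - short_arc m d.
Proof. by rewrite /short_arc; do !case: ifP; lia. Qed.

Lemma short_arc_le (m : nat) (d : int) :
  `|d| < m%:Z -> `|short_arc m d| *+ 2 <= m%:Z.
Proof. by rewrite /short_arc; do !case: ifP; lia. Qed.

Lemma short_arc_mod (m : nat) (d : int) :
  exists q : int, short_arc m d = d + q * m%:Z.
Proof.
rewrite /short_arc; case: ifP => _; first by exists (-1); rewrite mulN1r.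
by case: ifP => _; [exists 1; rewrite mul1r|exists 0; rewrite mul0r addr0].
Qed.

Lemma short_arc_eq0 (m : nat) (d : int) :
  `|d| < m%:Z -> short_arc m d = 0 -> d = 0.
Proof. by rewrite /short_arc; do !case: ifP; lia. Qed.

(** A shift of the label difference by [m] moves the argument by pi, which only flips the sign of
    the sine. *)
Lemma sin_short_arc {R : realType} (m : nat) (d : int) : (0 < m)%N ->
  `|sin (pi * (short_arc m d)%:~R / m%:R : R)| = `|sin (pi * d%:~R / m%:R)|.
Proof.
move=> m0; have m0' : m%:R != 0 :> R by rewrite pnatr_eq0 -lt0n.
rewrite /short_arc; case: ifP => _.
  rewrite intrB -[X in `|X|]opprK -sinDpi normrN.
  by congr (`|sin _|); field.
case: ifP => _ //.
rewrite intrD (_ : _ * _ / _ = pi * d%:~R / m%:R + pi); last by field.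
by rewrite sinDpi normrN.
Qed.

(** * Distances between corners of the clustered polygons *)

Section ClusteredNgons.
Context {R : realType} (D m : nat).

(* The [a]-th point: corner [a] (mod [m]) of a regular [m]-gon of radius 1 whose
   centre lies at [10 * (a %/ m)] on the first axis. *)
Definition cluster_point (a : nat) : 'rV[R]_D :=
  \row_(i < D) if val i == 0%N then 10 * (a %/ m)%:R + cos (2 * pi * a%:R / m%:R)
               else if val i == 1%N then sin (2 * pi * a%:R / m%:R) else 0.

Lemma edist_cluster_point (a b : nat) : (2 <= D)%N ->
  Defs.edist (cluster_point a) (cluster_point b) =
  Num.sqrt ((10 * (a %/ m)%:R + cos (2 * pi * a%:R / m%:R)
             - (10 * (b %/ m)%:R + cos (2 * pi * b%:R / m%:R))) ^+ 2
            + (sin (2 * pi * a%:R / m%:R) - sin (2 * pi * b%:R / m%:R)) ^+ 2).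
Proof.
rewrite /Defs.edist /cluster_point.
move: D => [|[|D']] // _.
rewrite !big_ord_recl /= !mxE /= big1 ?addr0 // => i _.
by rewrite !mxE /= subrr expr0n.
Qed.

(** Distinct centres are at least 10 apart on the first axis, and each cosine moves a point by at
    most 1. *)
Lemma edist_cluster_point_far (a b : nat) : (2 <= D)%N ->
  (a %/ m)%N != (b %/ m)%N ->
  8 <= Defs.edist (cluster_point a) (cluster_point b).
Proof.
move=> D2 ab; rewrite edist_cluster_point //.
set X := _ - (_ + _); set Y := _ - _.
suff H : 8 <= `|X|.
  rewrite -(ler_sqr) ?nnegrE ?sqrtr_ge0 // sqr_sqrtr ?addr_ge0 ?sqr_ge0 //.
  rewrite (@le_trans _ _ (`|X| ^+ 2)) //; first by rewrite ler_sqr ?nnegrE.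
  by rewrite real_normK ?num_real // lerDl sqr_ge0.
rewrite /X ler_normr.
have := cos_le1 (2 * pi * a%:R / m%:R : R); have := cos_geN1 (2 * pi * a%:R / m%:R : R).
have := cos_le1 (2 * pi * b%:R / m%:R : R); have := cos_geN1 (2 * pi * b%:R / m%:R : R).
move: ab; rewrite neq_ltn => /orP[]; rewrite -(ler_nat R) -natr1 => ? ? ? ? ?;
apply/orP; [right|left]; lra.
Qed.

(** A chord of the unit circle is twice the sine of half its central angle. *)
Lemma edist_cluster_point_near (a b : nat) : (2 <= D)%N -> (0 < m)%N ->
  (a %/ m)%N = (b %/ m)%N ->
  Defs.edist (cluster_point a) (cluster_point b) =
  2 * `|sin (pi * (short_arc m (b%:Z - a%:Z))%:~R / m%:R : R)|.
Proof.
move=> D2 m0 ab; rewrite edist_cluster_point // ab sin_short_arc //.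
have m0' : m%:R != 0 :> R by rewrite pnatr_eq0 -lt0n.
rewrite -[RHS]ger0_norm ?mulr_ge0 // -sqrtr_sqr; congr Num.sqrt.
rewrite exprMn real_normK ?num_real //.
set x := 2 * pi * a%:R / m%:R; set y := 2 * pi * b%:R / m%:R.
set z := pi * _ / _; have -> : y = x + z *+ 2.
  rewrite /y /z /x intrB mulr2n -!pmulrn; field.
  exact: m0'.
rewrite cosD (sinD x) sin_mulr2n cos_mulr2n.
have := cos2Dsin2 x; have := cos2Dsin2 z.
move: (cos x) (sin x) (cos z) (sin z) => cx sx cz sz.
move=> e1 e2.
have -> : cz ^+ 2 = 1 - sz ^+ 2 by rewrite -e1 addrK.
rewrite !mulr2n.
transitivity ((cx ^+ 2 + sx ^+ 2) * (4 * sz ^+ 2 * (cz ^+ 2 + sz ^+ 2))); last first.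
  by rewrite e1 e2; ring.
by ring.
Qed.

(** A short arc has at most [m / 2] steps, so the half-angle stays in [0, pi/2], where Jordan's
    inequality applies. *)
Lemma edist_cluster_point_ge (a b : nat) : (2 <= D)%N -> (0 < m)%N ->
  (a %/ m)%N = (b %/ m)%N ->
  4 / m%:R * `|(short_arc m (b%:Z - a%:Z))%:~R| <=
  Defs.edist (cluster_point a) (cluster_point b).
Proof.
move=> D2 m0 ab; rewrite edist_cluster_point_near //.
have m0' : 0 < m%:R :> R by rewrite ltr0n.
have pi0 := pi_gt0 R.
have dm : `|b%:Z - a%:Z| < m%:Z.
  rewrite (divn_eq a m) (divn_eq b m) ab.
  by have := ltn_pmod a m0; have := ltn_pmod b m0; lia.
have := short_arc_le _ _ dm; set w := short_arc _ _ => wm.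
have wm' : `|w%:~R| * 2 <= m%:R :> R.
  by rewrite -intr_norm -(ler_int R) in wm *; rewrite mulr2n intrD in wm; lra.
have -> : `|sin (pi * w%:~R / m%:R : R)| = `|sin (pi * `|w%:~R| / m%:R)|.
  case: (lerP 0 w) => w0; first by rewrite (ger0_norm (_ : 0 <= w%:~R)) // ler0z.
  by rewrite (ltr0_norm (_ : w%:~R < 0)) ?ltrz0 // mulrN mulNr sinN normrN.
set v := pi * `|w%:~R| / m%:R.
have vI : 0 <= v <= pi / 2.
  apply/andP; split; first by rewrite divr_ge0 ?mulr_ge0 // ltW.
  rewrite ler_pdivrMr // mulrAC ler_pdivlMr //.
  by rewrite -mulrA ler_pM2l.
apply: (@le_trans _ _ (2 * (2 / pi * v))).
  rewrite le_eqVlt; apply/orP; left; apply/eqP; rewrite /v {v vI}; move: (pi : R) pi0 => q q0; field.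
  by rewrite !gt_eqF.
by rewrite ler_pM2l // (le_trans (jordan_sin _ vI)) // ler_norm.
Qed.

Lemma edist_cluster_point_step (a b : nat) : (2 <= D)%N -> (0 < m)%N ->
  (a %/ m)%N = (b %/ m)%N -> `|short_arc m (b%:Z - a%:Z)| = 1 ->
  Defs.edist (cluster_point a) (cluster_point b) <= 2 * pi / m%:R.
Proof.
move=> D2 m0 ab w1; rewrite edist_cluster_point_near // -[2 * pi / _]mulrA ler_pM2l //.
have m0' : 0 < m%:R :> R by rewrite ltr0n.
have pm0 : 0 <= pi / m%:R :> R by rewrite divr_ge0 ?pi_ge0 // ltW.
have pmpi : pi / m%:R <= pi :> R.
  by rewrite ler_pdivrMr // ler_peMr ?pi_ge0 // ler1n.
have -> : `|sin (pi * (short_arc m (b%:Z - a%:Z))%:~R / m%:R : R)| = sin (pi / m%:R).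
  rewrite -[RHS]ger0_norm; last by rewrite sin_ge0_pi // pm0.
  have [->|->] : short_arc m (b%:Z - a%:Z) = 1 \/ short_arc m (b%:Z - a%:Z) = -1 by lia.
    by rewrite mulr1.
  by rewrite mulrN1z mulrN mulr1 mulNr sinN normrN.
exact: sin_le_id.
Qed.

Lemma cluster_point_inj : (2 <= D)%N -> (0 < m)%N -> injective cluster_point.
Proof.
move=> D2 m0 a b ab.
have e0 : Defs.edist (cluster_point a) (cluster_point b) = 0.
  by rewrite ab /Defs.edist big1 ?sqrtr0 // => i _; rewrite subrr expr0n.
have [abm|/(edist_cluster_point_far _ _ D2)] := eqVneq (a %/ m)%N (b %/ m)%N; last first.
  by rewrite e0 lern0.
have := edist_cluster_point_ge _ _ D2 m0 abm; rewrite e0.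
have m0' : 0 < m%:R :> R by rewrite ltr0n.
rewrite pmulr_rle0 ?divr_gt0 // normr_le0 intr_eq0 => /eqP/short_arc_eq0 H.
suff : b%:Z - a%:Z = 0 by lia.
apply: H; rewrite (divn_eq a m) (divn_eq b m) abm.
by have := ltn_pmod a m0; have := ltn_pmod b m0; lia.
Qed.

End ClusteredNgons.

(** * Linear algebra of cochains *)

(* Linear dependency of [k.+1] cochains modulo coboundaries: there are
   [n + k.+1] unknowns against
   [#|E| + 1 = n + k] linear equations, the extra one being [h v0 = 0]. *)
Lemma cochain_dependency {F : fieldType} (n k : nat) (E : {set 'I_n * 'I_n})
    (w : 'I_k.+1 -> 'I_n -> 'I_n -> F) (v0 : 'I_n) :
  #|E| = (n.-1 + k)%N ->
  exists (h : 'I_n -> F) (c : 'I_k.+1 -> F),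
    [/\ h v0 = 0, (exists v, h v != 0) \/ (exists j, c j != 0) &
        forall e, e \in E ->
          h e.2 - h e.1 = \sum_j c j * w j e.1 e.2].
Proof.
move=> cardE.
have n0 : (0 < n)%N by apply: leq_ltn_trans (ltn_ord v0).
pose ev (l : 'I_#|E|) := enum_val l.
(* Rows are the unknowns [h] and [c]; columns are the edge equations and the normalisation at [v0].
   A nonzero left kernel vector is the solution. *)
pose M : 'M[F]_(n + k.+1, #|E| + 1) :=
  block_mx (\matrix_(v, l) ((v == (ev l).2)%:R - (v == (ev l).1)%:R))
           (\matrix_(v, l) (v == v0)%:R)
           (\matrix_(j, l) - w j (ev l).1 (ev l).2) 0.
have /rowV0Pn[u] : kermx M != 0.
  rewrite kermx_eq0 /row_free neq_ltn; apply/orP; left.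
  apply: leq_ltn_trans (rank_leq_col _) _; rewrite cardE; lia.
rewrite -[u]hsubmxK sub_kermx => + u0.
rewrite mul_row_block mulmx0 addr0 -[X in _ == X]row_mx0 => /eqP /eq_row_mx [eE e0].
exists (fun v => u ord0 (lshift k.+1 v)), (fun j => u ord0 (rshift n j)); split.
- have := congr1 (fun A : 'M[F]_(1, 1) => A ord0 ord0) e0.
  rewrite !mxE (bigD1 v0) //= !mxE eqxx mulr1 big1 ?addr0 //.
  by move=> v /negPf vv0; rewrite !mxE vv0 mulr0.
- apply: contrapT => /not_orP [H1 H2]; move/eqP: u0; apply.
  have Hl : lsubmx u = 0.
    by apply/rowP => i; rewrite !mxE; apply: contrapT => /eqP ?; apply: H1; exists i.
  have Hr : rsubmx u = 0.
    by apply/rowP => i; rewrite !mxE; apply: contrapT => /eqP ?; apply: H2; exists i.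
  by rewrite Hl Hr row_mx0.
move=> e eE'; have := congr1 (fun A : 'M[F]_(1, _) => A ord0 (enum_rank_in eE' e)) eE.
rewrite !mxE /=.
under eq_bigr do rewrite !mxE mulrBr /ev enum_rankK_in //.
under [X in _ + X]eq_bigr do rewrite !mxE mulrN /ev enum_rankK_in //.
have S a : \sum_i u ord0 (lshift k.+1 i) * (i == a)%:R = u ord0 (lshift k.+1 a).
  rewrite (bigD1 a) //= eqxx mulr1 big1 ?addr0 // => i /negPf ->.
  by rewrite mulr0.
rewrite sumrB sumrN !S => /eqP; rewrite subr_eq0 => /eqP.
exact.
Qed.

(** Cyclic increments telescope to 0, whereas increments all equal to 1 would sum to [m], nonzero in
    characteristic 0. *)
Lemma exists_step_neq1 {F : numFieldType} (m : nat) (f : nat -> F) : (0 < m)%N ->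
  exists2 r, (r < m)%N & f (r.+1 %% m)%N - f r != 1.
Proof.
move=> m0; apply: contrapT => H.
have H' r : (r < m)%N -> f (r.+1 %% m)%N - f r = 1.
  by move=> rm; apply: contrapT => /eqP h; apply: H; exists r.
have S r : (r < m)%N -> f r = f 0%N + r%:R.
  elim: r => [|r IH] rm; first by rewrite addr0.
  have := H' r (ltnW rm); rewrite modn_small // => h.
  rewrite -(subrK (f r) (f r.+1)) h IH ?(ltnW rm) // -natr1; ring.
case: m m0 H' S {H} => // m _ H' S.
have /eqP := H' m (ltnSn m); rewrite modnn (S m) // opprD addNKr eq_sym -subr_eq0.
by rewrite opprK addrC natr1 pnatr_eq0.
Qed.

(** * Walks and dilation *)

Lemma edist_ge0 {R : realType} (D : nat) (x y : 'rV[R]_D) : 0 <= Defs.edist x y.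
Proof. exact: sqrtr_ge0. Qed.

Lemma walk_len_ge0 {R : realType} (D n : nat) (p : 'I_n -> 'rV[R]_D) x s :
  0 <= walk_len p x s.
Proof. by elim: s x => //= y s IH x; rewrite addr_ge0 ?edist_ge0. Qed.

Lemma path_const {n : nat} {T : Type} (E : {set 'I_n * 'I_n}) (h : 'I_n -> T) x s :
  (forall e, e \in E -> h e.1 = h e.2) -> path (adj E) x s -> h (last x s) = h x.
Proof.
move=> hE; elim: s x => //= y s IH x /andP[/orP xy /IH ->].
by case: xy => /hE.
Qed.

Lemma edist_gt0 {R : realType} (D : nat) (x y : 'rV[R]_D) :
  x != y -> 0 < Defs.edist x y.
Proof.
move=> xy; rewrite sqrtr_gt0 lt_def sumr_ge0 ?andbT => [|i _]; last exact: sqr_ge0.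
apply: contra xy; rewrite psumr_eq0 => [/allP H|i _]; last exact: sqr_ge0.
apply/eqP/rowP => i; have := H i; rewrite mem_index_enum => /(_ isT).
by rewrite sqrf_eq0 subr_eq0 => /eqP.
Qed.

Lemma graph_dist_le_dilation {R : realType} (D n : nat) (p : 'I_n -> 'rV[R]_D)
    (E : {set 'I_n * 'I_n}) (u v : 'I_n) (x : R) :
  injective p -> u != v ->
  ((x * Defs.edist (p u) (p v))%:E <= graph_dist p E u v)%E ->
  (x%:E <= dilation p E)%E.
Proof.
move=> pI uv H; apply: le_ereal_sup_tmp.
exists (graph_dist p E u v * (Defs.edist (p u) (p v))^-1%:E)%E; first by exists (u, v).
by rewrite lee_pdivlMr ?edist_gt0 ?(inj_eq pI).
Qed.

(** The step closing the polygon has [q = -1]; for [m = 2] its arc is -1, hence the absolute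
    value. *)
Lemma short_arc_succ (m j r : nat) : (1 < m)%N -> (r < m)%N ->
  `|short_arc m ((j * m + r.+1 %% m)%N%:Z - (j * m + r)%N%:Z)| = 1
  /\ exists q : int, (j * m + r.+1 %% m)%N%:Z - (j * m + r)%N%:Z = 1 + q * m%:Z.
Proof.
move=> m1; rewrite leq_eqVlt => /orP[/eqP rm|rm].
  rewrite rm modnn; split; last by exists (-1); lia.
  by rewrite /short_arc; do !case: ifP; lia.
rewrite modn_small //; split; last by exists 0; lia.
by rewrite /short_arc; do !case: ifP; lia.
Qed.

(** * Detours in a graph on the clusters *)

Section ClusteredGraph.
Context {R : realType} (D n m : nat) (E : {set 'I_n * 'I_n}).
Hypotheses (D2 : (2 <= D)%N) (m2 : (2 <= m)%N).

Let p (i : 'I_n) : 'rV[R]_D := cluster_point D m i.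

(* Along a walk inside cluster [j] the potential [g] changes by the total signed
   number of polygon steps; leaving the cluster costs at least 8. *)
Lemma walk_len_cluster (g : 'I_n -> R) (j : nat) (x : 'I_n) (s : seq 'I_n) :
  (forall a b : 'I_n, (a %/ m)%N = j -> (b %/ m)%N = j -> adj E a b ->
     g b - g a = (short_arc m (b%:Z - a%:Z))%:~R) ->
  (x %/ m)%N = j -> path (adj E) x s ->
  8 <= walk_len p x s \/
  exists z q : int, [/\ g (last x s) - g x = z%:~R,
    z = (last x s)%:Z - x%:Z + q * m%:Z & 4 / m%:R * `|z%:~R| <= walk_len p x s].
Proof.
move=> gE; elim: s x => [|y s IH] x xj /=.
  move=> _; right; exists 0, 0.
  by split; [rewrite subrr|rewrite mul0r subrr|rewrite normr0 mulr0].
have m0 : (0 < m)%N by apply: ltnW.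
have m0' : 0 < m%:R :> R by rewrite ltr0n.
move=> /andP[xy ys]; have [yj|yj] := eqVneq (y %/ m)%N j; last first.
  left; rewrite (le_trans (edist_cluster_point_far (R := R) D m x y D2 _)) ?xj 1?eq_sym //.
  by rewrite lerDl walk_len_ge0.
have xym : (x %/ m)%N = (y %/ m)%N by rewrite xj yj.
have [len8|[z [q [gz zq zlen]]]] := IH y yj ys.
  by left; rewrite (le_trans len8) // lerDr edist_ge0.
right; have [q' wq'] := short_arc_mod m (y%:Z - x%:Z).
exists (short_arc m (y%:Z - x%:Z) + z), (q' + q); split.
- by rewrite -(subrK (g y) (g (last y s))) -addrA gz gE // addrC intrD.
- by rewrite wq' zq; lia.
- apply: le_trans (lerD (edist_cluster_point_ge (R := R) D m x y D2 m0 xym) zlen).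
  rewrite -mulrDr; apply: ler_wpM2l; first by rewrite divr_ge0 // ltW.
  by rewrite intrD ler_normD.
Qed.

Lemma dilation_clusters (k : nat) : (0 < n)%N -> (k.+1 * m <= n)%N ->
  #|E| = (n.-1 + k)%N -> ((2 / pi * m%:R - 1)%:E <= dilation p E)%E.
Proof.
move=> n0 kmn cardE.
have m0 : (0 < m)%N by apply: ltnW.
have m0' : 0 < m%:R :> R by rewrite ltr0n.
have pI : injective p.
  by move=> a b /(@cluster_point_inj R _ _ D2 m0) /val_inj.
pose v0 := Ordinal n0.
(* On an edge inside cluster [j], only the [j]-th of these cochains can be nonzero. *)
pose w (j : 'I_k.+1) (a b : 'I_n) : R :=
  if (a %/ m == j)%N && (b %/ m == j)%N then (short_arc m (b%:Z - a%:Z))%:~R else 0.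
have [h [c [h0 hc hE]]] := cochain_dependency n k E w v0 cardE.
have [[j cj]|c0] := pselect (exists j, c j != 0); last first.
  (* With all coefficients zero, [h] is constant along edges, yet it is 0 at [v0] and nonzero at
     [v]: no walk joins them and their distance is infinite. *)
  have [[v hv]|//] := hc.
  have vv0 : v0 != v by apply: contraNneq hv => <-; rewrite h0.
  apply: (graph_dist_le_dilation _ _ p E v0 v (2 / pi * m%:R - 1) pI vv0).
  apply: le_ereal_inf_tmp => _ [s /= /andP[s0 /eqP sv]] <-.
  exfalso; move/eqP: hv; apply; rewrite -sv (path_const E h _ _ _ s0) // => e eE.
  apply/esym/eqP; rewrite -subr_eq0 hE // big1 // => j _.
  suff -> : c j = 0 by rewrite mul0r.
  by apply: contrapT => /eqP cj; apply: c0; exists j.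
pose g (a : 'I_n) := h a / c j.
have gEdge (a b : 'I_n) : (a %/ m)%N = j -> (b %/ m)%N = j -> (a, b) \in E ->
    g b - g a = (short_arc m (b%:Z - a%:Z))%:~R.
  move=> aj bj abE; rewrite /g -mulrBl (hE _ abE) /=.
  rewrite (bigD1 j) //= big1 => [|i ij].
    by rewrite addr0 /w aj bj eqxx /= mulrAC divff // mul1r.
  by rewrite /w aj (negPf (_ : (j : nat) != i)) ?mulr0 // eq_sym.
have gAdj (a b : 'I_n) : (a %/ m)%N = j -> (b %/ m)%N = j -> adj E a b ->
    g b - g a = (short_arc m (b%:Z - a%:Z))%:~R.
  move=> aj bj /orP[|]; first exact: gEdge.
  move=> /(gEdge b a bj aj) gba.
  by rewrite -[b%:Z - _]opprB short_arcN intrN -gba opprB.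
have jmn r : (r < m)%N -> (j * m + r < n)%N.
  move=> rm; apply: leq_trans kmn.
  apply: (@leq_trans (j.+1 * m)); last by rewrite leq_mul2r ltn_ord orbT.
  by rewrite mulSn addnC ltn_add2r.
(* The default [v0] is never returned for [r < m], by [jmn]. *)
pose vtx r := insubd v0 (j * m + r)%N.
have vtxE r : (r < m)%N -> vtx r = (j * m + r)%N :> nat.
  by move=> rm; rewrite /vtx val_insubd jmn.
have vtxj r : (r < m)%N -> (vtx r %/ m)%N = j.
  by move=> rm; rewrite vtxE // divnMDl // divn_small // addn0.
have [r rm gr] := exists_step_neq1 m (fun r => g (vtx r)) m0.
have r'm : (r.+1 %% m < m)%N by rewrite ltn_mod.
move: gr; set u := vtx r; set v := vtx _ => gr.
have [] := short_arc_succ m j r m2 rm.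
rewrite -!vtxE // -/u -/v => w1 [q0 uvq0].
have uvm : (u %/ m)%N = (v %/ m)%N by rewrite !vtxj.
have uv : u != v by apply/eqP => uv; rewrite uv subrr /short_arc in w1; move: w1; do !case: ifP; lia.
apply: (graph_dist_le_dilation _ _ p E u v (2 / pi * m%:R - 1) pI uv).
set d := Defs.edist _ _.
have d1 : 4 / m%:R <= d.
  have := edist_cluster_point_ge (R := R) D m u v D2 m0 uvm.
  by rewrite -intr_norm w1 mulr1.
have d2 : d <= 2 * pi / m%:R by exact: edist_cluster_point_step.
have pi0 := pi_gt0 R.
(* By [d2] the term [2 / pi * m * d] is at most 4, and by [d1] the term [- d] is at most
   [- 4 / m]. *)
have bound : (2 / pi * m%:R - 1) * d <= 4 / m%:R * (m%:R - 1).
  rewrite mulrBl mul1r mulrBr mulr1 divfK ?gt_eqF // lerB //.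
  apply: le_trans (ler_wpM2l _ d2) _; first by rewrite mulr_ge0 ?divr_ge0 // ltW.
  rewrite le_eqVlt; apply/orP; left; apply/eqP.
  move: (pi : R) pi0 => t t0; field.
  by rewrite !gt_eqF.
apply: le_ereal_inf_tmp => _ [s /= /andP[us /eqP sv]] <-.
rewrite lee_fin (le_trans bound) //.
have [len8|[z [q [gz zq zlen]]]] := walk_len_cluster g j u s gAdj (vtxj _ rm) us.
  (* A walk leaving the cluster already costs 8, more than [4 - 4 / m]. *)
  apply: le_trans len8; rewrite mulrBr mulr1 divfK ?gt_eqF //.
  have : 0 <= 4 / m%:R :> R by rewrite divr_ge0 // ltW.
  by lra.
apply: le_trans zlen; rewrite ler_pM2l ?divr_gt0 //.
have z1 : z != 1 by apply: contraNneq gr => z1; rewrite sv z1 in gz; rewrite gz.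
(* [z] is 1 plus a nonzero multiple of [m]. *)
have : m%:Z - 1 <= `|z|.
  move: z1; rewrite zq sv uvq0 -addrA -mulrDl; move: (q0 + q) => t t1.
  have : t <> 0 by move=> t0; rewrite t0 mul0r addr0 eqxx in t1.
  by move: m2; clear; nia.
by rewrite -(ler_int R) intrB intr_norm.
Qed.

End ClusteredGraph.

(** Settles the case of polygons with at most one corner, where the claimed bound is at most 0
    because [pi >= 2]. *)
Lemma dilation_ge0 {R : realType} (D n : nat) (p : 'I_n -> 'rV[R]_D)
    (E : {set 'I_n * 'I_n}) : (1 < n)%N -> (0 <= dilation p E)%E.
Proof.
move=> n1; have n0 := ltnW n1; apply: le_ereal_sup_tmp.
exists (graph_dist p E (Ordinal n0) (Ordinal n1) *
  (Defs.edist (p (Ordinal n0)) (p (Ordinal n1)))^-1%:E)%E.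
  by exists (Ordinal n0, Ordinal n1).
apply: mule_ge0; last by rewrite lee_fin invr_ge0 edist_ge0.
by apply: le_ereal_inf_tmp => _ [s _ <-]; rewrite lee_fin walk_len_ge0.
Qed.

Theorem theorem2 (R : realType) (D n k : nat) :
  (2 <= D)%N -> (0 < k)%N -> (k < n)%N ->
  (((2 / pi) * ((n %/ k.+1)%N)%:R - 1)%:E <= @delta R D n k)%E.
Proof.
move=> D2 k0 kn; have n1 : (1 < n)%N by apply: leq_ltn_trans kn.
set m := (n %/ k.+1)%N; pose m' := maxn m 1.
have m'0 : (0 < m')%N by rewrite leq_max orbT.
apply: le_ereal_sup_tmp.
exists (Delta_S (fun i : 'I_n => cluster_point D m' i : 'rV[R]_D) k).
  by exists (fun i : 'I_n => cluster_point D m' i) => // a b /(@cluster_point_inj R _ _ D2 m'0) /val_inj.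
apply: le_ereal_inf_tmp => _ [E [_ cardE] <-].
have [m2|m1] := ltnP 1 m.
  rewrite /m' (maxn_idPl (ltnW m2)); apply: dilation_clusters cardE => //.
    exact: ltnW.
  by rewrite mulnC leq_divM.
apply: le_trans (dilation_ge0 _ _ _ _ n1).
rewrite lee_fin subr_le0 mulrAC ler_pdivrMr ?pi_gt0 // mul1r.
apply: le_trans (pi_ge2 R); rewrite ler_piMr // -[1]/(1%N%:R) ler_nat.
exact: m1.
Qed.
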